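(* Let $n \ge 1$, let $A_L, A_R \in \mathbb{R}^{n \times n}$ and $b, c \in \mathbb{R}^n$, and suppose $A_R = A_L + p c^{\mathsf T}$ for some $p \in \mathbb{R}^n$. Let $g : \mathbb{R}^n \to \mathbb{R}^n$ be the piecewise-linear continuous map $$g(x) = \begin{cases} A_L x + b, & c^{\mathsf T} x < 0, \\ A_R x + b, & c^{\mathsf T} x \ge 0. \end{cases}$$ Suppose $\lambda \in \mathbb{R}$ is an eigenvalue of algebraic multiplicity one of $A_L$ and also an eigenvalue of algebraic multiplicity one of $A_R$. Let $u^{\mathsf T}$ and $v$ be left and right eigenvectors, respectively, of $A_R$ corresponding to $\lambda$. Suppose also that $\lambda \ne 1$ and $c^{\mathsf T} v \ne 0$. Then for every $x \in \mathbb{R}^n$, $$\phi(g(x)) = \lambda\, \phi(x),$$ where $$\phi(x) = u^{\mathsf T} x - \frac{u^{\mathsf T} b}{1 - \lambda}.$$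
   Context: A left eigenvector of $A_R$ corresponding to $\lambda$ is a row vector $u^{\mathsf T}$, with $u \in \mathbb{R}^n$ non-zero, satisfying $u^{\mathsf T} A_R = \lambda u^{\mathsf T}$; a right eigenvector is a non-zero $v \in \mathbb{R}^n$ with $A_R v = \lambda v$. The condition $A_R = A_L + p c^{\mathsf T}$ expresses continuity of $g$ on the switching manifold $\{x \in \mathbb{R}^n : c^{\mathsf T} x = 0\}$. *)

(* Defs.v *)
From mathcomp Require Import all_boot all_order all_algebra.
From mathcomp Require Import reals.

Set Implicit Arguments.
Unset Strict Implicit.
Unset Printing Implicit Defensive.

Import Order.TTheory GRing.Theory Num.Theory.

Local Open Scope ring_scope.

Definition dotp (R : realType) (n : nat) (u x : 'cV[R]_n) : R :=
  (u^T *m x) 0 0.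

Definition left_eigenvector (R : realType) (n : nat) (A : 'M[R]_n) (lambda : R)
    (u : 'cV[R]_n) : Prop :=
  u != 0 /\ u^T *m A = lambda *: u^T.

Definition right_eigenvector (R : realType) (n : nat) (A : 'M[R]_n) (lambda : R)
    (v : 'cV[R]_n) : Prop :=
  v != 0 /\ A *m v = lambda *: v.

Definition algebraic_multiplicity (R : realType) (n : nat) (A : 'M[R]_n)
    (lambda : R) : nat :=
  mup lambda (char_poly A).

Definition pwl_map (R : realType) (n : nat) (AL AR : 'M[R]_n) (b c : 'cV[R]_n)
    (x : 'cV[R]_n) : 'cV[R]_n :=
  if dotp c x < 0 then AL *m x + b else AR *m x + b.

Definition phi (R : realType) (n : nat) (b u : 'cV[R]_n) (lambda : R)
    (x : 'cV[R]_n) : R :=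
  dotp u x - dotp u b / (1 - lambda).

(* Main.v *)
Require Import Defs.
From mathcomp Require Import all_boot all_order all_algebra.
From mathcomp Require Import reals.
From mathcomp Require Import ring.

Import Order.TTheory GRing.Theory Num.Theory.
Local Open Scope ring_scope.

(** The content of the statement is that the left eigenvector [u] of [AR]
    satisfies [u^T p = 0].  Once this is known, [u^T AL = u^T AR = lambda u^T],
    so on either side of the switching manifold
    [u^T (g x) = lambda u^T x + u^T b], and the constant
    [u^T b / (1 - lambda)] in [phi] is the one that absorbs the affine term.

    To obtain [u^T p = 0], start from a left eigenvector [w] of [AL] for
    [lambda] and evaluate [w AR v] in two ways, letting [AR = AL + p c^T] act on
    [w] or on [v].  The terms [lambda w v] cancel, leaving [(w p) (c^T v) = 0],
    hence [w p = 0] because [c^T v] is nonzero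
    ([left_eigenvector_orthogonal_to_jump]).  Therefore [w] is also a left
    eigenvector of [AR].  Simplicity of [lambda] for [AR] makes the left
    eigenspace a line ([mxrank_eigenspace_le_mup]), so [w] is a nonzero multiple
    of [u^T] and [u^T p] vanishes too. *)

(** Extend a basis of the [r]-dimensional eigenspace to an invertible [P]: each
    of the first [r] rows of [P ('X - A)] is ['X - a] times a row of [P], so
    ['X - a] can be pulled out of the determinant [r] times, while [\det P] is a
    nonzero constant. *)
Lemma mxrank_eigenspace_le_mup (F : fieldType) (n : nat) (A : 'M[F]_n) (a : F) :
  (\rank (eigenspace A a) <= mup a (char_poly A))%N.
Proof.
set K := eigenspace A a; set r := \rank K; set P := row_ebase K.
have rn : (r <= n)%N by exact: rank_leq_row.
have eigP (i : 'I_n) : (i < r)%N -> row i P *m A = a *: row i P.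
  move=> ir; apply/eigenspaceP.
  have -> : row i P = row (Ordinal ir) (row_base K).
    rewrite /row_base row_mul [LHS]rowE; congr (_ *m _).
    by apply/rowP => j; rewrite !mxE /= ir andbT eq_sym.
  by rewrite (submx_trans (row_sub _ _)) // eq_row_base.
pose M := map_mx polyC P *m char_poly_mx A.
pose d : 'rV[{poly F}]_n := \row_i (if (i < r)%N then 'X - a%:P else 1).
pose C := \matrix_(i, j) (if (i < r)%N then (P i j)%:P else M i j).
have MdC : M = diag_mx d *m C.
  apply/matrixP => i j; rewrite mul_diag_mx !mxE.
  case: ifP => ir; last by rewrite mul1r.
  have /rowP/(_ j) := eigP i ir; rewrite -row_mul !mxE => eij.
  under eq_bigr do rewrite !mxE mulrBr -polyCM.
  rewrite sumrB -rmorph_sum eij rmorphM mulrBl; congr (_ - _).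
  rewrite (bigD1 j) //= eqxx mulr1n big1 ?addr0 1?mulrC // => k /negPf kj.
  by rewrite kj mulr0n mulr0.
have detP0 : \det P != 0 by rewrite -unitfE -unitmxE row_ebase_unit.
have detd : \det (diag_mx d) = ('X - a%:P) ^+ r.
  rewrite det_diag; under eq_bigr do rewrite mxE.
  by rewrite -big_mkcond (big_ord_narrow rn) prodr_const card_ord.
rewrite mup_geq ?monic_neq0 ?char_poly_monic //.
rewrite -(dvdpZr _ _ detP0) -mul_polyC -det_map_mx -det_mulmx.
by rewrite -/M MdC det_mulmx detd dvdp_mulIl.
Qed.

(** Since the rank-one jump [p c] sees [v], comparing the actions of [A + p c]
    on [w] and on [v] forces [w] to annihilate [p]. *)
Lemma left_eigenvector_orthogonal_to_jump (F : fieldType) (n : nat)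
    (A : 'M[F]_n) (p v : 'cV[F]_n) (c w : 'rV[F]_n) (a : F) :
    w *m A = a *: w -> (A + p *m c) *m v = a *: v -> c *m v != 0 ->
  w *m p = 0.
Proof.
move=> wA Av cv0.
have : w *m ((A + p *m c) *m v) = w *m (a *: v) by rewrite Av.
rewrite mulmxDl mulmxDr !mulmxA wA -scalemxAl -scalemxAr -[RHS]addr0.
move/addrI; rewrite -mulmxA [w *m p]mx11_scalar mul_scalar_mx => /eqP.
by rewrite scaler_eq0 (negPf cv0) orbF => /eqP ->; rewrite raddf0.
Qed.

Theorem proposition3p1 (R : realType) (n : nat) (n_ge1 : (1 <= n)%N)
    (AL AR : 'M[R]_n) (b c p : 'cV[R]_n) (hcont : AR = AL + p *m c^T)
    (lambda : R)
    (eigL : eigenvalue AL lambda)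
    (multL : algebraic_multiplicity AL lambda = 1%N)
    (eigR : eigenvalue AR lambda)
    (multR : algebraic_multiplicity AR lambda = 1%N)
    (u v : 'cV[R]_n)
    (hu : left_eigenvector AR lambda u) (hv : right_eigenvector AR lambda v)
    (lambda_neq1 : lambda != 1) (hcv : dotp c v != 0) :
  forall x : 'cV[R]_n,
    phi b u lambda (pwl_map AL AR b c x) = lambda * phi b u lambda x.
Proof.
have [u0 uAR] := hu; have [_ ARv] := hv.
have up0 : u^T *m p = 0.
  have [w wAL w0] := eigenvalueP eigL.
  have wp0 : w *m p = 0.
    apply: (left_eigenvector_orthogonal_to_jump _ _ _ _ v c^T _ _ wAL).
      by rewrite -hcont.
    by apply: contraNneq hcv => cv0; rewrite /dotp cv0 mxE.
  have wK : (w <= eigenspace AR lambda)%MS.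
    by apply/eigenspaceP; rewrite hcont mulmxDr mulmxA wp0 mul0mx addr0.
  have uK : (u^T <= eigenspace AR lambda)%MS by apply/eigenspaceP.
  have rk_u : \rank u^T = 1%N by rewrite rank_rV trmx_eq0 u0.
  have Ku : (eigenspace AR lambda <= u^T)%MS.
    rewrite -(geq_leqif (mxrank_leqif_sup uK)) rk_u -multR.
    exact: mxrank_eigenspace_le_mup.
  have /sub_rVP[k wE] := submx_trans wK Ku.
  move/eqP: wp0; rewrite wE -scalemxAl scaler_eq0 => /orP[/eqP k0|/eqP //].
  by rewrite wE k0 scale0r eqxx in w0.
have uAL : u^T *m AL = lambda *: u^T.
  by rewrite -uAR hcont mulmxDr mulmxA up0 mul0mx addr0.
have dotpg x : dotp u (pwl_map AL AR b c x) = lambda * dotp u x + dotp u b.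
  by rewrite /dotp /pwl_map; case: ifP => _;
    rewrite mulmxDr mulmxA ?uAL ?uAR -scalemxAl !mxE.
have lambda1 : 1 - lambda != 0 by rewrite subr_eq0 eq_sym.
by move=> x; rewrite /phi dotpg; field.
Qed.
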